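(* Let $i\ne j$ be indices in $\{1,\dots,n\}$, let $\beta\in\mathbb{R}$ be such that $\frac{\mu_i-\beta}{\mu_j-\beta}$ is defined and positive, and let $u=(u_1,\dots,u_n)\in E^n$. Suppose that $(\beta,u)$ solves the $i$-th equation of the system, i.e. $$-\Delta u_i+a(x)u_i=\mu_iu_i^3+\beta\sum_{k\ne i}u_k^2u_i,\qquad u_i>0,$$ and suppose that $$u_j=\left(\frac{\mu_i-\beta}{\mu_j-\beta}\right)^{1/2}u_i.$$ Then the $j$-th equation also holds: $$-\Delta u_j+a(x)u_j=\mu_ju_j^3+\beta\sum_{k\ne j}u_k^2u_j,\qquad u_j>0.$$
   Context: Setting. Let $n\ge 2$, $N\le 3$, let $\Omega\subset\mathbb{R}^N$ be a (possibly unbounded) domain invariant under a closed subgroup $G\subset O(N)$, and let $a\in L^\infty_{\rm loc}(\Omega)$ be $G$-invariant such that $-\Delta+a$ is a positive self-adjoint operator on $L^2(\Omega)$. Put $E:=\{u\in H^1_0(\Omega): u \text{ is } G\text{-invariant},\ \int_\Omega a u^2<\infty\}$ with norm $\|u\|_E^2=\int_\Omega|\nabla u|^2+\int_\Omega a u^2$, and assume that the embedding $E\hookrightarrow L^4(\Omega)$ is compact. Fix $0<\mu_1\le\dots\le\mu_n$. Equations are understood in the weak sense. *)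

(* Defs.v *)
(* Developed over MathComp-Analysis: [R : realType], and R^N is ['rV[R]_N].   *)
From HB Require Import structures.
From mathcomp Require Import all_boot all_order all_algebra.
From mathcomp Require Import all_classical all_reals all_analysis.

Set Implicit Arguments.
Unset Strict Implicit.
Unset Printing Implicit Defensive.

Import Order.TTheory GRing.Theory Num.Theory.
Import numFieldNormedType.Exports.

Local Open Scope classical_set_scope.
Local Open Scope ring_scope.

(* The Borel sigma-algebra of R^n, generated by the coordinates (as the       *)
(* library does for [n.-tuple R]).                                            *)
Definition rV_display : measure_display.
Proof. exact: default_measure_display. Qed.

Section measurable_rV.
Context {R : realType} {n : nat}.

Let coord_rV (i : 'I_n) (x : 'rV[R]_n) : R := x ord0 i.

Let rV_set0 : g_sigma_preimage coord_rV set0.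
Proof. exact: sigma_algebra0. Qed.

Let rV_setC A : g_sigma_preimage coord_rV A -> g_sigma_preimage coord_rV (~` A).
Proof. exact: sigma_algebraC. Qed.

Let rV_bigcup (F : (set 'rV[R]_n)^nat) :
  (forall i, g_sigma_preimage coord_rV (F i)) ->
  g_sigma_preimage coord_rV (\bigcup_i (F i)).
Proof. exact: sigma_algebra_bigcup. Qed.

HB.instance Definition _ := @isMeasurable.Build rV_display 'rV[R]_n
  (g_sigma_preimage coord_rV) rV_set0 rV_setC rV_bigcup.

End measurable_rV.

Lemma measurable_coord {R : realType} n (i : 'I_n) :
  measurable_fun [set: 'rV[R]_n] (fun x : 'rV[R]_n => x ord0 i).
Proof.
move=> _ Y mY; rewrite setTI; apply: sub_sigma_algebra => /=.
rewrite -bigcup_seq/=; exists i => /=; first by rewrite mem_index_enum.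
by exists Y => //; rewrite setTI.
Qed.

Lemma measurable_fun_rV {R : realType} d (T : measurableType d) n
    (f : T -> 'rV[R]_n) :
  (forall i, measurable_fun setT (fun t => f t ord0 i)) -> measurable_fun setT f.
Proof.
move=> mf _ Y mY; rewrite setTI.
have : (@measurable _ 'rV[R]_n `<=` [set A | measurable (f @^-1` A)]).
  apply: smallest_sub.
    split => /=.
    - by rewrite preimage_set0.
    - by move=> A mA; rewrite setTD preimage_setC; exact: measurableC.
    - by move=> F mF; rewrite preimage_bigcup; exact: bigcup_measurable.
  move=> A; rewrite -bigcup_seq/= => -[i _ [B mB <-]] /=.
  by rewrite setTI -[X in measurable X]setTI; exact: (mf i measurableT B mB).
exact.
Qed.

(* Lebesgue measure on R^n as the n-fold product of [lebesgue_measure].       *)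
Section lebesgue_rV.
Context {R : realType}.

Definition rV_cons n (p : R * 'rV[R]_n) : 'rV[R]_n.+1 :=
  row_mx (p.1%:M : 'rV[R]_1) p.2.

Definition rV_uncons n (x : 'rV[R]_n.+1) : R * 'rV[R]_n :=
  (x ord0 ord0, @rsubmx _ 1 1 n x).

Lemma rV_consK n : cancel (@rV_cons n) (@rV_uncons n).
Proof.
move=> [x v]; rewrite /rV_uncons /rV_cons /=; congr pair; last exact: row_mxKr.
transitivity (rV_cons (x, v) ord0 (lshift n (ord0 : 'I_1))).
  by congr (fun_of_matrix _ _ _); exact/val_inj.
by rewrite [LHS](@row_mxEl _ 1 1 n) mxE eqxx.
Qed.

Lemma measurable_rV_cons n : measurable_fun [set: R * 'rV[R]_n] (@rV_cons n).
Proof.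
apply: measurable_fun_rV => i.
have [j ->|j ->] := @split_ordP 1 n i.
  rewrite (_ : (fun _ => _) = fst); first exact: measurable_fst.
  by apply/funext => t; rewrite [LHS](@row_mxEl _ 1 1 n) mxE (ord1 j) eqxx.
rewrite (_ : (fun _ => _) = (fun v : 'rV[R]_n => v ord0 j) \o snd).
  by apply: measurableT_comp; [exact: measurable_coord|exact: measurable_snd].
by apply/funext => t; rewrite [LHS](@row_mxEr _ 1 1 n).
Qed.

Lemma measurable_rV_uncons n :
  measurable_fun [set: 'rV[R]_n.+1] (@rV_uncons n).
Proof.
apply/measurable_fun_pairP; split; first exact: measurable_coord.
apply: measurable_fun_rV => i /=.
rewrite (_ : (fun _ => _) =
    (fun v : 'rV[R]_n.+1 => v ord0 (rshift 1 i : 'I_n.+1))).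
  exact: measurable_coord.
by apply/funext => t; rewrite mxE.
Qed.

Section product_rV.
Variables (n : nat)
  (m1 : {sigma_finite_measure set (measurableTypeR R) -> \bar R})
  (m2 : {sigma_finite_measure set 'rV[R]_n -> \bar R}).

Definition product_rV : set 'rV[R]_n.+1 -> \bar R :=
  pushforward (m1 \x m2)%E (@rV_cons n).

Let mcons := @measurable_rV_cons n.

Let product_rV0 : product_rV set0 = 0%E.
Proof. exact: measure0. Qed.

Let product_rV_ge0 A : (0 <= product_rV A)%E.
Proof. exact: measure_ge0. Qed.

Let product_rV_sigma_additive : semi_sigma_additive product_rV.
Proof. exact: measure_semi_sigma_additive. Qed.

HB.instance Definition _ := isMeasure.Build _ _ _ product_rV
  product_rV0 product_rV_ge0 product_rV_sigma_additive.

Let sigma_finite_product_rV : sigma_finite setT product_rV.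
Proof.
have /sigma_finiteP[F [TF ndF Foo]] := sigma_finiteT m1.
have /sigma_finiteP[G [TG ndG Goo]] := sigma_finiteT m2.
exists (fun k => @rV_uncons n @^-1` (F k `*` G k)).
  rewrite -preimage_bigcup (_ : \bigcup_k _ = setT) ?preimage_setT//.
  rewrite -subTset => -[x y] _.
  have [k _ Fkx] : (\bigcup_k F k) x by rewrite -TF.
  have [l _ Gly] : (\bigcup_k G k) y by rewrite -TG.
  exists (maxn k l) => //; split.
  - by move: x Fkx; exact/subsetPset/ndF/leq_maxl.
  - by move: y Gly; exact/subsetPset/ndG/leq_maxr.
move=> k; have [mF Fk] := Foo k; have [mG Gk] := Goo k; split.
  rewrite -[X in measurable X]setTI; apply: measurable_rV_uncons => //.
  exact: measurableX.
rewrite /product_rV /pushforward -comp_preimage (_ : _ \o _ = id).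
  by rewrite preimage_id product_measure1E// lte_mul_pinfty// ge0_fin_numE.
by apply/funext; exact: rV_consK.
Qed.

HB.instance Definition _ := Measure_isSigmaFinite.Build _ _ _ product_rV
  sigma_finite_product_rV.

End product_rV.

Fixpoint lebesgue_rV n : {sigma_finite_measure set 'rV[R]_n -> \bar R} :=
  if n is m.+1 then product_rV lebesgue_measure (lebesgue_rV m)
  else dirac (0 : 'rV[R]_0).

Lemma lebesgue_rV_box n (A : 'I_n -> set R) :
  (forall i, measurable (A i)) ->
  lebesgue_rV n [set x : 'rV[R]_n | forall i, A i (x ord0 i)] =
  (\prod_(i < n) (@lebesgue_measure R (A i)))%E.
Proof.
elim: n A => [|n IH] A mA.
  by rewrite big_ord0 /= diracE mem_set// => -[].
rewrite big_ord_recl -(IH (fun i => A (lift ord0 i)))//=.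
rewrite -[RHS]product_measure1E//; last first.
  rewrite [X in measurable X](_ : _ =
    \bigcap_i (fun x : 'rV[R]_n => x ord0 i) @^-1` A (lift ord0 i)).
    apply: fin_bigcap_measurable => // i _.
    by rewrite -[X in measurable X]setTI; exact: measurable_coord.
  by apply/seteqP; split => x /= xA i; [move=> _|]; exact: xA.
- exact: mA.
rewrite /product_rV /pushforward; apply: (congr1 (_ \x _)%E).
apply/seteqP; split => -[x v] /=.
- move=> xvA; split => [|i].
    by have := xvA ord0; rewrite -[X in A _ X]/((rV_uncons _).1) rV_consK.
  by have := xvA (lift ord0 i); rewrite (_ : lift ord0 i = rshift 1 i);
    [rewrite [X in A _ X](@row_mxEr _ 1 1 n)|exact/val_inj].
- move=> [xA vA] i; have [j ->|j ->] := @split_ordP 1 n i.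
    rewrite [X in A _ X](@row_mxEl _ 1 1 n) mxE (ord1 j) eqxx.
    by rewrite (_ : (lshift n (ord0 : 'I_1) : 'I_n.+1) = ord0)//; exact/val_inj.
  rewrite [X in A _ X](@row_mxEr _ 1 1 n).
  by rewrite (_ : (rshift 1 j : 'I_n.+1) = lift ord0 j)//; exact/val_inj.
Qed.

End lebesgue_rV.

Section function_spaces.
Context {R : realType} {N : nat}.
Implicit Types (Omega : set 'rV[R]_N) (u v f a phi : 'rV[R]_N -> R).

Local Notation leb := (@lebesgue_rV R N).

Definition ae_in Omega (P : 'rV[R]_N -> Prop) : Prop :=
  {ae leb, forall x, Omega x -> P x}.

Definition domain Omega : Prop :=
  [/\ open Omega, connected Omega & Omega !=set0].

(* Elements of Lebesgue and Sobolev spaces are represented by Borel functions *)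
(* on R^N of which only the restriction to Omega matters, up to equality      *)
(* almost everywhere.                                                         *)
Definition Lp (p : R) Omega u : Prop := u \_ Omega \in Lfun leb p%:E.

Definition Lp_cvg (p : R) Omega (u_ : nat -> 'rV[R]_N -> R) u : Prop :=
  ('N[leb]_p%:E[EFin \o ((u_ k - u)%R \_ Omega)])%E @[k --> \oo] --> 0%E.

Definition Linfty_loc Omega a : Prop :=
  measurable_fun Omega a /\
  forall K, compact K -> K `<=` Omega ->
    exists M : R, ae_in K (fun x => `|a x| <= M).

Definition partial (i : 'I_N) phi : 'rV[R]_N -> R := 'D_(delta_mx ord0 i) phi.

Definition partials (s : seq 'I_N) phi : 'rV[R]_N -> R := foldr partial phi s.

Definition smooth phi : Prop :=
  forall s : seq 'I_N, continuous (partials s phi) /\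
    forall (i : 'I_N) (x : 'rV[R]_N),
      derivable (partials s phi) x (delta_mx ord0 i).

(* phi \in C_c^\infty(Omega) *)
Definition test_function Omega phi : Prop :=
  [/\ smooth phi, compact (closure [set x | phi x != 0])
    & closure [set x | phi x != 0] `<=` Omega].

Definition weak_gradient Omega u (g : 'I_N -> 'rV[R]_N -> R) : Prop :=
  [/\ Lp 2 Omega u, forall i, Lp 2 Omega (g i)
    & forall phi, test_function Omega phi -> forall i,
        \int[leb]_(x in Omega) (u x * partial i phi x) =
        - \int[leb]_(x in Omega) (g i x * phi x)].

Definition H1 Omega u : Prop := exists g, weak_gradient Omega u g.

(* The weak gradient of u \in H^1(Omega), unique up to equality a.e. *)
Definition wgrad Omega u : 'I_N -> 'rV[R]_N -> R :=
  xget (fun _ _ => 0) [set g | weak_gradient Omega u g].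

(* H^1_0(Omega) is the closure of C_c^\infty(Omega) in H^1(Omega). *)
Definition H10 Omega u : Prop :=
  H1 Omega u /\
  exists phi_ : nat -> 'rV[R]_N -> R,
    [/\ forall k, test_function Omega (phi_ k), Lp_cvg 2 Omega phi_ u
      & forall i, Lp_cvg 2 Omega (fun k => partial i (phi_ k))
                                 (wgrad Omega u i)].

(* - \Delta u + a u = f in Omega, in the weak sense *)
Definition weak_solution Omega a u f : Prop :=
  forall phi, test_function Omega phi ->
    \sum_(i < N) \int[leb]_(x in Omega) (wgrad Omega u i x * partial i phi x)
    + \int[leb]_(x in Omega) (a x * u x * phi x)
    = \int[leb]_(x in Omega) (f x * phi x).

(* (Real) unbounded operators on L^2(Omega) are given by their graphs. *)
Section operators.
Variables (Omega : set 'rV[R]_N).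
Variable T : ('rV[R]_N -> R) -> ('rV[R]_N -> R) -> Prop.

Definition inner u v : R := \int[leb]_(x in Omega) (u x * v x).

Definition densely_defined : Prop :=
  forall w, Lp 2 Omega w ->
    exists u_ f_ : nat -> 'rV[R]_N -> R,
      (forall k, T (u_ k) (f_ k)) /\ Lp_cvg 2 Omega u_ w.

Definition adjoint v g : Prop :=
  [/\ Lp 2 Omega v, Lp 2 Omega g & forall u f, T u f -> inner f v = inner u g].

Definition self_adjoint : Prop :=
  densely_defined /\ forall v g, T v g <-> adjoint v g.

Definition positive_operator : Prop :=
  forall u f, T u f -> ~ ae_in Omega (fun x => u x = 0) -> 0 < inner f u.

End operators.

Definition potential_integrable Omega a u : Prop :=
  leb.-integrable Omega (fun x => (a x * u x ^+ 2)%:E).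

(* The graph of - \Delta + a on L^2(Omega) with Dirichlet boundary conditions *)
Definition schrodinger Omega a u f : Prop :=
  [/\ H10 Omega u, potential_integrable Omega a u, Lp 2 Omega f
    & weak_solution Omega a u f].

Definition closed_orthogonal_subgroup (G : set 'M[R]_N) : Prop :=
  [/\ closed G, forall A, G A -> A *m A^T = 1%:M, G 1%:M,
      forall A B, G A -> G B -> G (A *m B)
    & forall A, G A -> G (invmx A)].

(* The image of x under A; points of R^N are row vectors. *)
Definition act (A : 'M[R]_N) (x : 'rV[R]_N) : 'rV[R]_N := x *m A^T.

Definition invariant_set (G : set 'M[R]_N) Omega : Prop :=
  forall A, G A -> [set act A x | x in Omega] = Omega.

Definition invariant_fun (G : set 'M[R]_N) Omega u : Prop :=
  forall A, G A -> ae_in Omega (fun x => u (act A x) = u x).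

Definition E_space Omega (G : set 'M[R]_N) a u : Prop :=
  [/\ H10 Omega u, invariant_fun G Omega u & potential_integrable Omega a u].

Definition E_norm Omega a u : R :=
  Num.sqrt (\sum_(i < N) \int[leb]_(x in Omega) (wgrad Omega u i x ^+ 2)
            + \int[leb]_(x in Omega) (a x * u x ^+ 2)).

Definition compact_embedding_L4 Omega (G : set 'M[R]_N) a : Prop :=
  (forall u, E_space Omega G a u -> Lp 4 Omega u) /\
  forall u_ : nat -> 'rV[R]_N -> R,
    (forall k, E_space Omega G a (u_ k)) ->
    (exists M : R, forall k, E_norm Omega a (u_ k) <= M) ->
    exists (s : nat -> nat) v,
      [/\ {homo s : k l / (k < l)%N}, Lp 4 Omega v
        & Lp_cvg 4 Omega (u_ \o s) v].

(* The i-th equation of the system, together with u_i > 0 *)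
Definition solves_equation Omega a n (mu : 'I_n -> R) (beta : R)
    (u : 'I_n -> 'rV[R]_N -> R) (i : 'I_n) : Prop :=
  weak_solution Omega a (u i)
    (fun x => mu i * u i x ^+ 3
              + beta * \sum_(k < n | k != i) u k x ^+ 2 * u i x) /\
  ae_in Omega (fun x => 0 < u i x).

End function_spaces.

(* Main.v *)
(* With s^2 = (mu_i - beta) / (mu_j - beta) and u_j = s u_i one has           *)
(* (mu_i - beta) u_i^2 = (mu_j - beta) u_j^2, so both right-hand sides have   *)
(* the form ((mu_k - beta) u_k^2 + beta \sum_l u_l^2) u_k with the same       *)
(* bracket, and the j-th equation is s times the i-th one.                    *)
Require Import Defs.
From mathcomp Require Import all_boot all_order all_algebra.
From mathcomp Require Import all_classical all_reals all_analysis.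
From mathcomp Require Import ring.
From mathcomp Require Import measurable_realfun.

Set Implicit Arguments.
Unset Strict Implicit.
Unset Printing Implicit Defensive.

Import Order.TTheory GRing.Theory Num.Theory.
Import numFieldNormedType.Exports.

Local Open Scope classical_set_scope.
Local Open Scope ring_scope.

(** The operator -Δ + a is linear, so u_j = s u_i solves an equation whose right-hand side is s
    times that of u_i; [cubic_coupling_scale] identifies it with the j-th nonlinearity, and
    positivity is inherited from s > 0. As u_j = s u_i holds only almost everywhere and [wgrad] is
    an arbitrary representative, [integral_wgrad_partial] moves both derivatives onto the test
    function, and [ae_eq_RintegralZl] then scales every integral in the weak equation. *)

Section integral_ae_scale.
Context d (T : measurableType d) (R : realType).
Variables (mu : {measure set T -> \bar R}) (D : set T).

Import HBNNSimple.

(** The integral of a nonnegative function is a supremum over simple functions h below it. Dividing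
    h by k and cutting it off on a null set A containing the exceptional points gives a competitor
    for g. *)
Lemma ge0_ae_le_integralZl (k : R) (f g : T -> \bar R) : 0 < k ->
  (forall x, D x -> (0 <= f x)%E) -> (forall x, D x -> (0 <= g x)%E) ->
  {ae mu, forall x, D x -> (f x <= k%:E * g x)%E} ->
  (\int[mu]_(x in D) f x <= k%:E * \int[mu]_(x in D) g x)%E.
Proof.
move=> k0 f0 g0 [A [mA A0 AP]].
rewrite ge0_integralE// ge0_integralE//.
apply: ge_ereal_sup => _ [h /= hf <-].
have k'0 : 0 <= k^-1 by rewrite invr_ge0 ltW.
have mCA : measurable (~` A) by exact: measurableC.
pose h' := scale_nnsfun (proj_nnsfun h mCA) k'0.
have h'E : sintegral mu h' = (k^-1%:E * sintegral mu (proj_nnsfun h mCA))%E.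
  by rewrite -sintegralrM.
have -> : sintegral mu h = (k%:E * sintegral mu h')%E.
  rewrite h'E muleA -EFinM divff ?gt_eqF// mul1e -!integralT_nnsfun.
  apply: ge0_ae_eq_integral => //.
  - by apply/measurable_EFinP; exact: measurable_funP.
  - by apply/measurable_EFinP; exact: measurable_funP.
  - by move=> x _; rewrite lee_fin.
  - by move=> x _; rewrite lee_fin.
  exists A; split => // x /=; apply: contra_notP => Ax _.
  by rewrite mindicE mem_set// mulr1.
rewrite lee_pmul2l ?lte_fin//; apply: ereal_sup_ubound; exists h' => //= x.
rewrite /= mindicE; have := hf x; rewrite !patchE; have [Dx|Dx] := ifPn.
  have {}Dx : D x by exact: set_mem.
  move=> hx; case: (pselect (A x)) => Ax.
    by rewrite memNset ?mulr0 ?g0//=; exact.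
  rewrite mem_set// mulr1 EFinM lee_pdivrMl//; apply: le_trans hx _.
  by apply: contrapT => ?; apply/Ax/AP => /= /(_ Dx).
rewrite lee_fin => hx; have -> : h x = 0.
  by apply/eqP; rewrite eq_le hx /=.
by rewrite mul0r mulr0.
Qed.

Lemma ge0_ae_eq_integralZl (k : R) (f g : T -> \bar R) : 0 < k ->
  (forall x, D x -> (0 <= f x)%E) -> (forall x, D x -> (0 <= g x)%E) ->
  {ae mu, forall x, D x -> f x = (k%:E * g x)%E} ->
  (\int[mu]_(x in D) f x = k%:E * \int[mu]_(x in D) g x)%E.
Proof.
move=> k0 f0 g0 fg; apply/eqP; rewrite eq_le; apply/andP; split.
  by apply: ge0_ae_le_integralZl => //; apply: filterS fg => x /[apply] ->.
rewrite -lee_pdivlMl//; apply: ge0_ae_le_integralZl; rewrite ?invr_gt0//.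
apply: filterS fg => x /[apply] ->.
by rewrite muleA -EFinM mulVf ?gt_eqF// mul1e.
Qed.

(* Scaling by a positive constant commutes with the suprema defining the      *)
(* integral and null sets do not affect them, so neither measurability nor    *)
(* integrability is required.                                                 *)
Lemma ae_eq_RintegralZl (k : R) (f g : T -> R) : 0 < k ->
  {ae mu, forall x, D x -> f x = k * g x} ->
  \int[mu]_(x in D) f x = k * \int[mu]_(x in D) g x.
Proof.
move=> k0 fg; rewrite /Rintegral integralE [in RHS]integralE.
rewrite (@ge0_ae_eq_integralZl k _ ((EFin \o g)^\+)%E)//; last first.
  apply: filterS fg => x /[apply] fgx; rewrite !funeposE /= fgx EFinM.
  by rewrite maxe_pMr ?lee_fin ?ltW// mule0.
rewrite (@ge0_ae_eq_integralZl k (_ ^\-)%E ((EFin \o g)^\-)%E)//; last first.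
  apply: filterS fg => x /[apply] fgx; rewrite !funenegE /= fgx -mulrN EFinM.
  by rewrite maxe_pMr ?lee_fin ?ltW// mule0.
(* Multiplication by k > 0 preserves infinite values, and [fine] sends these to 0, so both sides
   vanish unless both parts have finite integrals. *)
case: (integral mu D _) => [p||]; case: (integral mu D _) => [q||];
  rewrite ?gt0_muley ?gt0_muleNy ?lte_fin//= ?mulr0//.
by rewrite mulrBr.
Qed.

End integral_ae_scale.

Section weak_equation.
Context {R : realType} {N : nat}.
Implicit Types (Omega : set 'rV[R]_N) (u v a f phi : 'rV[R]_N -> R).

(** Off its closed support, [phi] is zero on a neighbourhood of the point, so its derivative there
    is that of a constant. *)
Lemma supp_partial (i : 'I_N) phi :
  closure [set x | partial i phi x != 0] `<=` closure [set x | phi x != 0].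
Proof.
rewrite [X in _ `<=` X](closure_id _).1; last exact: closed_closure.
apply: closureS => x /= dphi0; apply: contrapT => xphi.
move/eqP: dphi0; apply.
rewrite /partial (near_eq_derive (g := cst 0)) ?derive_cst//.
have : nbhs x (~` closure [set y | phi y != 0]).
  by apply: open_nbhs_nbhs; split => //; exact/closed_openC/closed_closure.
apply: filterS => y /= yphi; apply: contrapT => /eqP phiy.
exact/yphi/subset_closure.
Qed.

Lemma test_function_partial Omega (i : 'I_N) phi :
  test_function Omega phi -> test_function Omega (partial i phi).
Proof.
move=> [sphi cphi phiO]; split.
- move=> s; have := sphi (rcons s i).
  by rewrite /partials foldr_rcons.
- by apply: subclosed_compact cphi (@supp_partial i phi); exact: closed_closure.
- exact: subset_trans (@supp_partial i phi) phiO.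
Qed.

Lemma wgradP Omega u : H1 Omega u -> weak_gradient Omega u (wgrad Omega u).
Proof. by move=> [g ug]; exact: (xgetPex (fun _ _ => 0) (ex_intro _ g ug)). Qed.

(* Partial derivatives of test functions are test functions: a second         *)
(* integration by parts removes the chosen weak gradient from the equation.   *)
Lemma integral_wgrad_partial Omega u (i : 'I_N) phi :
  H1 Omega u -> test_function Omega phi ->
  \int[lebesgue_rV N]_(x in Omega) (wgrad Omega u i x * partial i phi x) =
  - \int[lebesgue_rV N]_(x in Omega) (u x * partial i (partial i phi) x).
Proof.
move=> /wgradP[_ _ ibp] tphi.
by rewrite (ibp _ (test_function_partial i tphi) i) opprK.
Qed.

(** Once the gradients are integrated by parts, only the values of u and v enter, so the chosen
    gradients of u and v are never compared. *)
Lemma weak_solution_scale Omega a u v f g (s : R) : 0 < s ->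
  H1 Omega u -> H1 Omega v ->
  ae_in Omega (fun x => v x = s * u x) ->
  ae_in Omega (fun x => g x = s * f x) ->
  weak_solution Omega a u f -> weak_solution Omega a v g.
Proof.
rewrite /ae_in => s0 Hu Hv vu gf uf phi tphi.
rewrite [RHS](@ae_eq_RintegralZl _ _ _ _ _ s _ (fun x => f x * phi x))//; last first.
  by apply: filterS gf => x /[apply] ->; rewrite mulrA.
rewrite -uf// mulrDr mulr_sumr; congr +%R.
  apply: eq_bigr => i _; rewrite !integral_wgrad_partial// mulrN; congr (- _).
  apply: ae_eq_RintegralZl => //.
  by apply: filterS vu => x /[apply] ->; rewrite mulrA.
apply: ae_eq_RintegralZl => //; apply: filterS vu => x /[apply] ->.
by rewrite (mulrCA (a x)) -!mulrA.
Qed.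

End weak_equation.

Lemma cubic_coupling_scale (F : fieldType) n (mu y : 'I_n -> F) (beta s : F)
    (i j : 'I_n) : i != j -> s ^+ 2 * (mu j - beta) = mu i - beta ->
  y j = s * y i ->
  mu j * y j ^+ 3 + beta * \sum_(k < n | k != j) y k ^+ 2 * y j =
  s * (mu i * y i ^+ 3 + beta * \sum_(k < n | k != i) y k ^+ 2 * y i).
Proof.
move=> ij sE yj; rewrite -!mulr_suml.
(* Each sum gives up the term of the other index; both remainders then run over the k distinct from
   i and j. *)
rewrite (bigD1 i)//= [in RHS](bigD1 j) 1?eq_sym//=.
rewrite [in RHS](eq_bigl (fun k => (k != j) && (k != i))); last first.
  by move=> k; rewrite andbC.
have -> : mu i = s ^+ 2 * (mu j - beta) + beta by rewrite sE subrK.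
rewrite yj; ring.
Qed.

Theorem lemma5p2 (R : realType) (N n : nat) (Omega : set 'rV[R]_N)
    (G : set 'M[R]_N) (a : 'rV[R]_N -> R) (mu : 'I_n -> R)
    (hn : (2 <= n)%N) (hN : (N <= 3)%N)
    (hOmega : domain Omega)
    (hG : closed_orthogonal_subgroup G)
    (hOmegaG : invariant_set G Omega)
    (ha : Linfty_loc Omega a)
    (haG : invariant_fun G Omega a)
    (hsa : self_adjoint Omega (schrodinger Omega a))
    (hpos : positive_operator Omega (schrodinger Omega a))
    (hE : compact_embedding_L4 Omega G a)
    (hmu0 : forall k, 0 < mu k)
    (hmu : forall k l : 'I_n, (k <= l)%N -> mu k <= mu l)
    (i j : 'I_n) (hij : i != j)
    (beta : R)
    (hdef : mu j - beta != 0)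
    (hratio : 0 < (mu i - beta) / (mu j - beta))
    (u : 'I_n -> 'rV[R]_N -> R)
    (hu : forall k, E_space Omega G a (u k))
    (hi : solves_equation Omega a mu beta u i)
    (huj : ae_in Omega
             (fun x => u j x = Num.sqrt ((mu i - beta) / (mu j - beta)) * u i x)) :
  solves_equation Omega a mu beta u j.
Proof.
have s0 : 0 < Num.sqrt ((mu i - beta) / (mu j - beta)) by rewrite sqrtr_gt0.
have H1u k : H1 Omega (u k) by have [[]] := hu k.
have [ui ui0] := hi; rewrite /ae_in in ui0 huj; split; last first.
  apply: filterS2 ui0 huj => x uix ujx Ox.
  by rewrite ujx// mulr_gt0// uix.
apply: (weak_solution_scale s0 (H1u i) (H1u j) huj _ ui).
apply: filterS huj => x /[apply] ujx.
apply: cubic_coupling_scale => //.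
by rewrite sqr_sqrtr ?ltW// divfK.
Qed.
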